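(* For all integers $1\le i\le n$, the Stirling numbers of the first kind satisfy the recursion $$s(n+1,i)=s(n,i-1)-n\,s(n,i).$$
   Context: The (signed) Stirling numbers of the first kind $s(n,k)$ are defined by $\prod_{k=0}^{n-1}(x-k)=\sum_{k=0}^n s(n,k)x^k$, or equivalently by $\frac{[\ln(1+x)]^m}{m!}=\sum_{k=m}^\infty\frac{s(k,m)}{k!}x^k$ for $|x|<1$. *)

(* Defs.v *)
From mathcomp Require Import all_boot all_order all_algebra.

Set Implicit Arguments.
Unset Strict Implicit.
Unset Printing Implicit Defensive.

Import GRing.Theory.
Local Open Scope ring_scope.

Definition falling_poly (n : nat) : {poly int} :=
  \prod_(j < n) ('X - (j%:Z)%:P).

(* Signed Stirling numbers of the first kind, s(n, k); 0 when k > n. *)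
Definition stirling1 (n k : nat) : int := (falling_poly n)`_k.

Lemma falling_polyE (n : nat) :
  falling_poly n = \sum_(k < n.+1) stirling1 n k *: 'X^k.
Proof.
have sz : size (falling_poly n) = n.+1.
  by rewrite /falling_poly size_prod_XsubC /index_enum -enumT size_enum_ord.
by rewrite -[LHS]coefK poly_def sz.
Qed.

(* Main.v *)
Require Import Defs.
From mathcomp Require Import all_boot all_order all_algebra.

Import GRing.Theory.
Local Open Scope ring_scope.

Theorem corollary2p4 (n i : nat) (hi : (1 <= i)%N) (hin : (i <= n)%N) :
  stirling1 n.+1 i = stirling1 n (i - 1)%N - n%:Z * stirling1 n i.
Proof.
(* Splitting off the last factor gives [falling_poly n.+1 = falling_poly n * ('X - n)]. In the
   coefficient of degree [i], the factor ['X] shifts the index down by one and the constant [n]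
   scales. *)
rewrite /stirling1 /falling_poly big_ord_recr /= mulrBr coefB coefMX coefMC.
(* [coefMX] leaves a case split with value 0 at index 0; [hi] selects the other branch, where [i.-1]
   is a true predecessor. *)
by rewrite eqn0Ngt hi subn1 [_ * n%:Z]mulrC.
Qed.
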